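(* Let $k\ge 1$ and let $G=(V,E)$ be an arbitrary undirected graph on $n$ nodes. Then there exists a data structure of size $O(k^2n+n^2)$ that stores a list of $O(kn)$ cuts of $G$ and answers each of the following queries, for any given pair $s,t\in V$, in $O(1)$ time: (con) determine whether $\kappa(s,t)\ge k+1$; (cut) if $\kappa(s,t)\le k$, return a pointer to an $st$-cut of size at most $k$ that belongs to the stored list.
   Context: For distinct nodes $s,t$ of an undirected graph $G=(V,E)$, $\kappa(s,t)$ denotes the maximum number of internally disjoint $st$-paths in $G$. An $st$-cut is a subset $C\subseteq V\cup E$ (not containing $s,t$) such that $G\setminus C$ has no $st$-path; by Menger's theorem $\kappa(s,t)$ equals the minimum size of an $st$-cut. Space is measured in machine words (the $O(\log n)$ factor for storing node indices is ignored). *)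

(* Defs.v *)
From mathcomp Require Import all_boot.

Set Implicit Arguments.
Unset Strict Implicit.
Unset Printing Implicit Defensive.

(* A graph on n nodes is a symmetric irreflexive relation on 'I_n;            *)
(* the word that represents a node is its ordinal value.                      *)

Section Graph.
Variable n : nat.
Implicit Types (e : rel 'I_n) (s t : 'I_n).

(* [w] is the full node sequence of the path, both ends included. *)
Definition st_path e s t (w : seq 'I_n) : bool :=
  if w is x :: p then [&& x == s, last x p == t, path e x p & uniq w]
  else false.

Definition inner s t (w : seq 'I_n) : seq 'I_n :=
  [seq x <- w | (x != s) && (x != t)].

Definition disjoint_paths e s t (P : {set n.-bseq 'I_n}) : bool :=
  [forall w in P, st_path e s t w] &&
  [forall w in P, forall w' in P,
     (w != w') ==> [disjoint inner s t w & inner s t w']].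

(* A path repeats no node, so node sequences of length at most n suffice.     *)
(* [P] is a set of paths, so the one-edge path st is counted at most once.    *)
Definition kappa e s t : nat :=
  \max_(P : {set n.-bseq 'I_n} | disjoint_paths e s t P) #|P|.

Definition edges e : {set {set 'I_n}} :=
  [set A | [exists x, exists y, e x y && (A == [set x; y])]].

(* Elements of the disjoint union of V and E: [inl v] is a node, [inr A] is   *)
(* an edge given as the set of its ends.                                      *)
Definition elt : finType := ('I_n + {set 'I_n})%type.

(* The graph G \ C; the deleted nodes remain in the type 'I_n, isolated. *)
Definition del e (C : {set elt}) : rel 'I_n :=
  [rel x y | [&& e x y, inl x \notin C, inl y \notin C
               & inr [set x; y] \notin C]].

Definition st_cut e s t (C : {set elt}) : Prop :=
  [/\ forall A, inr A \in C -> A \in edges e,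
      inl s \notin C, inl t \notin C
    & forall w, ~~ st_path (del e C) s t w].

Definition is_cut e (C : {set elt}) : Prop :=
  exists s t, s != t /\ st_cut e s t C.

(* A node v takes the two words v, v and an edge takes its two ends in        *)
(* increasing order; a cut is its size followed by its elements.              *)
Definition encode_elt (x : elt) : seq nat :=
  match x with
  | inl v => [:: val v; val v]
  | inr A => [seq val v | v <- enum A]
  end.

Definition encode_cut (C : {set elt}) : seq nat :=
  #|C| :: flatten [seq encode_elt x | x <- enum C].

(* The memory of a data structure consists of arbitrary auxiliary words       *)
(* followed by the records of the listed cuts.                                *)
Record ds := DS { ds_aux : seq nat; ds_cuts : seq {set elt} }.

Definition ds_mem (D : ds) : seq nat :=
  ds_aux D ++ flatten [seq encode_cut C | C <- ds_cuts D].

(* The address of the first word of the i-th record. *)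
Definition ds_ptr (D : ds) (i : nat) : nat :=
  size (ds_aux D) + size (flatten [seq encode_cut C | C <- take i (ds_cuts D)]).

End Graph.

(* A RAM with W-bit words, finitely many registers used by each program, and  *)
(* read-only random access to the memory [M].  Natural subtraction is         *)
(* truncated; the other operations are modulo 2 ^ W.                          *)
Inductive instr : Type :=
| IConst (d c : nat)
| IAdd (d a b : nat)
| ISub (d a b : nat)
| IMul (d a b : nat)
| ILoad (d a : nat)
| IJlt (a b l : nat)
| IHalt (a : nat).

Definition upd (r : nat -> nat) (d v : nat) : nat -> nat :=
  fun i => if i == d then v else r i.

(* [exec W M p T pc r = Some v] iff [p], started at [pc] with registers [r],  *)
(* halts with output [v] after at most [T] instructions; an access outside    *)
(* [M] and a jump outside [p] are faults.                                     *)
Fixpoint exec (W : nat) (M : seq nat) (p : seq instr) (T pc : nat)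
    (r : nat -> nat) : option nat :=
  if T is T'.+1 then
    let next d v := exec W M p T' pc.+1 (upd r d v) in
    match onth p pc with
    | Some (IConst d c) => next d (c %% 2 ^ W)
    | Some (IAdd d a b) => next d ((r a + r b) %% 2 ^ W)
    | Some (ISub d a b) => next d (r a - r b)
    | Some (IMul d a b) => next d ((r a * r b) %% 2 ^ W)
    | Some (ILoad d a) => if r a < size M then next d (nth 0 M (r a)) else None
    | Some (IJlt a b l) => exec W M p T' (if r a < r b then l else pc.+1) r
    | Some (IHalt a) => Some (r a)
    | None => None
    end
  else None.

(* The query (s, t) is passed in registers 0 and 1. *)
Definition query (W : nat) (M : seq nat) (p : seq instr) (T s t : nat) :
    option nat :=
  exec W M p T 0 (upd (upd (fun=> 0) 0 s) 1 t).

(* Words of O(log n) bits; for c > 0 every node index fits in one word. *)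
Definition word_bits (c n : nat) : nat := c * (trunc_log 2 n).+1.

(* Main.v *)
Require Import Defs.
From mathcomp Require Import all_boot.
From mathcomp Require Import zify.

Set Implicit Arguments.
Unset Strict Implicit.
Unset Printing Implicit Defensive.

(* A cut of size at most k splits a set U of terminals into two sides and at *)
(* most k remaining nodes; it serves every pair with one end on each side.    *)
(* If the smaller side has a <= 3k terminals, list one cut for each of the at *)
(* most 4ka other pairs that meet it and discard this side; otherwise recurse *)
(* on each side together with the remaining nodes.  This gives O(kn) cuts,    *)
(* each with O(k) words, and an n x n table of pointers answers the queries.  *)
(* That a cut of size at most kappa(s, t) exists is Menger's theorem, derived *)
(* from Konig's: a matching of copies of nodes, where v may be matched to     *)
(* itself, is a partial injection whose orbits are disjoint paths.            *)

(** One cut of size at most k serves every pair across its two sides, so only pairs within a side or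
    touching the at most k leftover terminals remain. Let a be the number of terminals on the
    smaller side. If a <= 3k, the unserved pairs that meet this side number at most a(a + k) <= 4ka,
    so O(k) cuts charged to each discarded terminal pay for them ([separating_peel]). If a > 3k,
    both sides are large, and a potential with a negative constant term absorbs the leftovers, which
    enter both recursive calls ([separating_split]). [separating_exists] combines the two cases.

    A table entry is a pointer if kappa(s, t) <= k and 0 otherwise, so the same load answers both
    queries. [menger] guarantees that every pair needing a pointer has a small cut: a minimum
    bipartite cover yields the cut, and the chains of a matching of the same size, counted in
    [linkage], yield the paths. *)

Section Konig.
Variables L R : finType.
Implicit Types (E M : {set L * R}) (P : {set L}) (Q : {set R}).

Definition vcover E P Q : bool :=
  [forall z in E, (z.1 \in P) || (z.2 \in Q)].

Definition matching M : Prop :=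
  {in M &, injective fst} /\ {in M &, injective snd}.

Lemma vcoverP E P Q :
  reflect (forall x y, (x, y) \in E -> (x \in P) || (y \in Q)) (vcover E P Q).
Proof.
by apply: (iffP forall_inP) => [H x y /H //|H [x y] /H].
Qed.

Lemma cardsU1_leS (T : finType) (x : T) (A : {set T}) : #|x |: A| <= #|A|.+1.
Proof. by rewrite cardsU1; case: (x \notin A). Qed.

(** Let t be the least size of a cover of E, and take M minimal under inclusion among the subsets of
    E that still need t nodes to cover. Such an M is a matching, and its left ends cover it, so t <=
    |M|. *)
Lemma konig E : exists M P Q,
  [/\ M \subset E, matching M, vcover E P Q & #|P| + #|Q| <= #|M|].
Proof.
pose large t M := [forall P, forall Q, vcover M P Q ==> (t <= #|P| + #|Q|)].
have largeP t M :
    reflect (forall P Q, vcover M P Q -> t <= #|P| + #|Q|) (large t M).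
  apply: (iffP forallP) => [H P Q|H P]; last by apply/forallP => Q; apply/implyP/H.
  by move/forallP: (H P) => /(_ Q)/implyP.
have cov0 : vcover E setT set0 by apply/vcoverP => x y _; rewrite inE.
case: (arg_minnP (fun PQ : {set L} * {set R} => #|PQ.1| + #|PQ.2|)
        (P := fun PQ => vcover E PQ.1 PQ.2) (i0 := (setT, set0)) cov0).
move=> [P Q] /= covPQ minPQ; set t := #|P| + #|Q| in minPQ *.
have lE : large t E by apply/largeP => P' Q' /(minPQ (P', Q')).
have [M minM sME] := minset_exists lE.
have lM := largeP _ _ (minsetp minM).
(* By minimality fewer than t nodes cover M without the edge (x, y); they avoid x and y, since
   otherwise they would cover M. *)
have covD x y : (x, y) \in M -> exists P' Q',
    [/\ forall u v, (u, v) \in M -> (u, v) != (x, y) -> (u \in P') || (v \in Q'),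
        #|P'| + #|Q'| < t, x \notin P' & y \notin Q'].
  move=> zM; have : ~~ large t (M :\ (x, y)).
    apply/negP => lz; have := minsetinf minM lz (subD1set _ _).
    by move/setP/(_ (x, y)); rewrite !inE eqxx zM.
  rewrite negb_forall => /existsP[P']; rewrite negb_forall => /existsP[Q'].
  rewrite negb_imply -ltnNge => /andP[/vcoverP cz lt].
  have cz' u v : (u, v) \in M -> (u, v) != (x, y) -> (u \in P') || (v \in Q').
    by move=> uvM ne; apply: cz; rewrite !inE ne.
  have : ~~ ((x \in P') || (y \in Q')).
    apply/negP => xy; move: lt; rewrite ltnNge lM //.
    by apply/vcoverP => u v uvM; have [[-> ->] //|] := eqVneq (u, v) (x, y); apply: cz'.
  by rewrite negb_or => /andP[? ?]; exists P', Q'.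
(* If two edges of M share a node, uncross the covers obtained by deleting one
   of them: (P1 & P2, Q1 | Q2) and (P1 | P2 with that node, Q1 & Q2) cover M. *)
exists M, P, Q; split=> //.
- split=> [[x y] [x' z]|[y x] [z x']] xyM xzM /= eq_x; subst x'.
    have [[-> //]|ne] := eqVneq (x, y) (x, z).
    have [P1 [Q1 [c1 lt1 xP1 yQ1]]] := covD _ _ xyM.
    have [P2 [Q2 [c2 lt2 xP2 zQ2]]] := covD _ _ xzM.
    have yQ2 : y \in Q2 by have := c2 _ _ xyM ne; rewrite (negPf xP2).
    have zQ1 : z \in Q1 by have := c1 _ _ xzM; rewrite eq_sym ne (negPf xP1) => /(_ isT).
    have l1 : t <= #|P1 :&: P2| + #|Q1 :|: Q2|.
      apply: lM; apply/vcoverP => u v uvM; rewrite !inE.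
      have [[_ ->]|/(c1 _ _ uvM)] := eqVneq (u, v) (x, y); first by rewrite yQ2 !orbT.
      have [[_ ->]|/(c2 _ _ uvM)] := eqVneq (u, v) (x, z); first by rewrite zQ1 !orbT.
      by do 4!case: (_ \in _).
    have l2 : t <= #|x |: (P1 :|: P2)| + #|Q1 :&: Q2|.
      apply: lM; apply/vcoverP => u v uvM; rewrite !inE.
      have [[-> _]|/(c1 _ _ uvM)] := eqVneq (u, v) (x, y); first by rewrite eqxx.
      have [[-> _]|/(c2 _ _ uvM)] := eqVneq (u, v) (x, z); first by rewrite eqxx.
      by do 4!case: (_ \in _); rewrite ?orbT.
    move: (cardsUI P1 P2) (cardsUI Q1 Q2) (cardsU1_leS x (P1 :|: P2)) l1 l2 lt1 lt2.
    by clear; lia.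
  have [[-> //]|ne] := eqVneq (y, x) (z, x).
  have [P1 [Q1 [c1 lt1 yP1 xQ1]]] := covD _ _ xyM.
  have [P2 [Q2 [c2 lt2 zP2 xQ2]]] := covD _ _ xzM.
  have yP2 : y \in P2 by have := c2 _ _ xyM ne; rewrite (negPf xQ2) orbF.
  have zP1 : z \in P1 by have := c1 _ _ xzM; rewrite eq_sym ne (negPf xQ1) orbF => /(_ isT).
  have l1 : t <= #|P1 :|: P2| + #|Q1 :&: Q2|.
    apply: lM; apply/vcoverP => u v uvM; rewrite !inE.
    have [[-> _]|/(c1 _ _ uvM)] := eqVneq (u, v) (y, x); first by rewrite yP2 !orbT.
    have [[-> _]|/(c2 _ _ uvM)] := eqVneq (u, v) (z, x); first by rewrite zP1 ?orbT.
    by do 4!case: (_ \in _).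
  have l2 : t <= #|P1 :&: P2| + #|x |: (Q1 :|: Q2)|.
    apply: lM; apply/vcoverP => u v uvM; rewrite !inE.
    have [[_ ->]|/(c1 _ _ uvM)] := eqVneq (u, v) (y, x); first by rewrite eqxx !orbT.
    have [[_ ->]|/(c2 _ _ uvM)] := eqVneq (u, v) (z, x); first by rewrite eqxx !orbT.
    by do 4!case: (_ \in _); rewrite ?orbT.
  move: (cardsUI P1 P2) (cardsUI Q1 Q2) (cardsU1_leS x (Q1 :|: Q2)) l1 l2 lt1 lt2.
  by clear; lia.
- apply: leq_trans (lM (fst @: M) set0 _) _; last first.
    by rewrite cards0 addn0 leq_imset_card.
  by apply/vcoverP => x y xyM; rewrite (imset_f fst xyM).
Qed.
End Konig.

(** * Disjoint chains of a partial injection *)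

Section Chains.
Variables (T : finType) (D : {set T}) (f : T -> T).
Hypothesis f_inj : {in D &, injective f}.

(** Injectivity traces both chains back in step; neither start has a preimage in D, so they reach
    their starts together. *)
Lemma chain_inj a b i j : a \notin f @: D -> b \notin f @: D ->
  (forall m, m < i -> iter m f a \in D) ->
  (forall m, m < j -> iter m f b \in D) ->
  iter i f a = iter j f b -> a = b /\ i = j.
Proof.
move=> aI bI; elim: i j => [|i IHi] [|j] Da Db //= eq_ab.
- by case/negP: aI; rewrite eq_ab imset_f ?Db.
- by case/negP: bI; rewrite -eq_ab imset_f ?Da.
- have eq' : iter i f a = iter j f b by apply: f_inj; rewrite ?Da ?Db.
  by have [m /ltnW/Da|m /ltnW/Db|-> ->] := IHi _ _ _ eq'.
Qed.

(** For a start outside f(D), iterates that stay in D are distinct, so by pigeonhole this bounded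
    search succeeds. *)
Definition exit_time (a : T) : nat :=
  find (fun i => iter i f a \notin D) (iota 0 #|T|.+1).

Lemma exit_time_before a i : i < exit_time a -> iter i f a \in D.
Proof.
move=> lt_i; have lt_iT : i < #|T|.+1.
  by apply: leq_trans lt_i _; rewrite -[X in _ <= X](size_iota 0) find_size.
by have := before_find 0 lt_i; rewrite nth_iota // => /negbFE.
Qed.

Lemma exit_timeP a : a \notin f @: D -> iter (exit_time a) f a \notin D.
Proof.
move=> aI; have exa : has (fun i => iter i f a \notin D) (iota 0 #|T|.+1).
  apply/negPn/negP => /hasPn Da.
  have {}Da i : i < #|T|.+1 -> iter i f a \in D.
    by move=> lt_i; apply/negPn/Da; rewrite mem_iota.
  have : injective (fun i : 'I_#|T|.+1 => iter i f a).
    move=> i j eq_ij; apply/val_inj.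
    by have [m lt_m|m lt_m|//] := chain_inj aI aI _ _ eq_ij; apply/Da/(ltn_trans lt_m).
  by move/leq_card; rewrite card_ord ltnn.
have := nth_find 0 exa; rewrite nth_iota //.
by rewrite -[X in _ < X](size_iota 0) -has_find.
Qed.

(** The exits of the chains from A are distinct and, like B, lie among the |T| - |D| points outside
    D; so at least |A| + |B| + |D| - |T| of them fall in B. X collects the starts of these
    chains. *)
Lemma linkage (A B : {set T}) : [disjoint A & f @: D] -> [disjoint B & D] ->
  exists2 X : {set T}, X \subset A & [/\ #|A| + #|B| + #|D| <= #|X| + #|T|,
    {in X, forall a, iter (exit_time a) f a \in B} &
    {in X &, forall a b i j, i <= exit_time a -> j <= exit_time b ->
       iter i f a = iter j f b -> a = b /\ i = j}].
Proof.
move=> dA dB; pose g a := iter (exit_time a) f a.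
have AI a : a \in A -> a \notin f @: D by move=> aA; rewrite (disjointFr dA aA).
have ginj : {in A &, injective g}.
  move=> a b aA bA eq_g.
  by have [m|m|//] := chain_inj (AI a aA) (AI b bA) _ _ eq_g; apply: exit_time_before.
exists [set a in A | g a \in B]; first by apply/subsetP => a; rewrite inE => /andP[].
split.
- have sU : #|g @: A :|: B| + #|D| <= #|T|.
    rewrite -(cardsC D) addnC leq_add2l; apply/subset_leq_card/subsetP => x.
    rewrite !inE => /orP[/imsetP[a aA ->]|xB]; first exact/exit_timeP/AI.
    by rewrite (disjointFr dB xB).
  have sI : #|g @: A :&: B| <= #|[set a in A | g a \in B]|.
    apply: leq_trans (leq_imset_card g _); apply/subset_leq_card/subsetP => x.
    by rewrite inE => /andP[/imsetP[a aA ->] gB]; apply: imset_f; rewrite inE aA.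
  move: (cardsUI (g @: A) B) sU sI; rewrite card_in_imset //; clear; lia.
- by move=> a; rewrite inE => /andP[].
- move=> a b; rewrite !inE => /andP[aA _] /andP[bA _] i j li lj.
  by apply: chain_inj (AI a aA) (AI b bA) _ _ => m lt_m;
    apply: exit_time_before; apply: leq_trans lt_m _.
Qed.

End Chains.

(** * Menger's theorem *)

Section Menger.
Variables (n : nat) (e : rel 'I_n).
Hypothesis e_irr : irreflexive e.
Implicit Types (s t x y : 'I_n) (C : {set elt n}).

Definition is_st_cut s t C : bool :=
  [&& [forall A, (inr A \in C) ==> (A \in edges e)],
      inl s \notin C, inl t \notin C & ~~ connect (del e C) s t].

Lemma is_st_cutP s t C : reflect (st_cut e s t C) (is_st_cut s t C).
Proof.
apply: (iffP and4P) => [[/forallP H1 H2 H3 H4]|[H1 H2 H3 H4]]; split=> //.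
- by move=> A; apply/implyP.
- case=> [|x p] //=; apply/negP => /and4P[/eqP-> /eqP lp pp _].
  by case/negP: H4; apply/connectP; exists p.
- by apply/forallP => A; apply/implyP/H1.
- apply/negP => /connectP[p pp lp]; case/shortenP: pp lp => p' pp' up' _ lp.
  by have := H4 (s :: p'); rewrite /st_path eqxx -lp eqxx pp' up'.
Qed.

Lemma kappa_geq s t (P : {set n.-bseq 'I_n}) :
  disjoint_paths e s t P -> #|P| <= kappa e s t.
Proof. by move=> dP; rewrite /kappa (bigD1 P) //= leq_maxl. Qed.

(** Each [w a] is the nonempty interior of a path, so the edge st, if present, is a further path. *)
Lemma kappa_ge_linkage s t (X : {set 'I_n}) (w : 'I_n -> seq 'I_n) : s != t ->
  {in X, forall a, a \in w a} ->
  {in X, forall a, st_path e s t (s :: rcons (w a) t)} ->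
  {in X &, forall a b x, x \in w a -> x \in w b -> a = b} ->
  #|X| + e s t <= kappa e s t.
Proof.
move=> neq_st wa wp wd; pose p a := insub_bseq n (s :: rcons (w a) t).
have size_le (q : seq 'I_n) : uniq q -> size q <= n.
  by move=> u; rewrite -(card_uniqP u) -[X in _ <= X](card_ord n) max_card.
have pE a : a \in X -> p a = s :: rcons (w a) t :> seq 'I_n.
  move=> /wp /and4P[_ _ _ u]; rewrite /p/insub_bseq insubdK //; exact: size_le.
pose p0 : n.-bseq 'I_n := insub_bseq n [:: s; t].
have p0E : p0 = [:: s; t] :> seq 'I_n.
  rewrite /p0/insub_bseq insubdK //; apply: size_le; by rewrite /= inE neq_st.
have pinj : {in X &, injective p}.
  move=> a b aX bX /(congr1 (@bseqval _ _)); rewrite !pE // => -[] /rcons_inj[eq_w].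
  by apply: (wd _ _ aX bX a); rewrite -?eq_w wa.
have p0X : p0 \notin p @: X.
  apply/imsetP => -[a aX /(congr1 (@bseqval _ _))]; rewrite pE // p0E => -[].
  by have := wa a aX; case: (w a) => // x [|? ?].
pose P := p @: X :|: (if e s t then [set p0] else set0).
have cP : #|P| = #|X| + e s t.
  rewrite /P; case: (e s t); last by rewrite setU0 card_in_imset ?addn0.
  by rewrite setUC cardsU1 p0X card_in_imset // addnC.
have inner_p a x : a \in X -> x \in inner s t (p a) -> x \in w a.
  move=> aX; rewrite mem_filter pE // inE mem_rcons inE.
  by case: eqP => //= _; case: eqP.
have inner_p0 x : (x \in inner s t p0) = false.
  by rewrite mem_filter p0E !inE; do 2!case: eqP.
have inP q : q \in P -> (exists2 a, a \in X & q = p a) \/ (e s t /\ q = p0).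
  rewrite inE => /orP[/imsetP[a aX ->]|]; first by left; exists a.
  by case: (e s t); rewrite inE // => /eqP->; right.
rewrite -cP; apply: kappa_geq; apply/andP; split.
  apply/forall_inP => q /inP[[a aX ->]|[est ->]]; first by rewrite pE // wp.
  by rewrite p0E /= !eqxx est inE neq_st.
apply/forall_inP => q qP; apply/forall_inP => q' q'P; apply/implyP.
move=> neq; rewrite disjoint_subset; apply/subsetP => x xq; rewrite inE.
apply/negP => xq'; case/eqP: neq.
case/inP: qP => [[a aX eq]|[_ eq]]; last by rewrite eq inner_p0 in xq.
case/inP: q'P => [[b bX eq']|[_ eq']]; last by rewrite eq' inner_p0 in xq'.
rewrite eq eq'; congr p; apply: (wd _ _ aX bX x); apply: inner_p => //.
  by rewrite -eq.
by rewrite -eq'.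
Qed.

Lemma card_sum (T : finType) (X : {set T}) : #|X| = \sum_x (x \in X).
Proof.
by rewrite -sum1_card big_mkcond; apply: eq_bigr => x _; case: (x \in X).
Qed.

(** The last bound allows k to be replaced by min(k, n) in the data structure. *)
Lemma menger s t : s != t ->
  exists C, [/\ st_cut e s t C, #|C| <= kappa e s t & #|C| <= n].
Proof.
move=> neq_st.
pose A := [set x | e s x & x != t]; pose B := [set x | e x t & x != s].
pose e' x y := [&& e x y, x \notin [set s; t] & y \notin [set s; t]].
(* A pair (x, y) with x != y is a step of a path; a pair (x, x) marks a node off the paths. No pair
   enters A or leaves B, so chains can start in A and end in B. *)
pose E := [set z : 'I_n * 'I_n |
  [&& z.1 \notin B, z.2 \notin A & (z.1 == z.2) || e' z.1 z.2]].
have [M [P [Q [sME [M1 M2] /vcoverP cov leM]]]] := konig E.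
(* The pairs (x, x) force P or Q to contain each x outside A and B, hence
   #|S| + n <= #|A| + #|B| + #|P| + #|Q|, counted node by node. *)
pose S := [set x | [|| (x \in P) && (x \in Q), (x \in P) && (x \in A),
                       (x \in Q) && (x \in B) | (x \in A) && (x \in B)]]
          :\: [set s; t].
pose C : {set elt n} := inl @: S :|: (if e s t then [set inr [set s; t]] else set0).
have cardC : #|C| <= #|S| + e s t.
  apply: leq_trans (leq_card_setU _ _) _; apply: leq_add; first exact: leq_imset_card.
  by case: (e s t); rewrite ?cards1 ?cards0.
have inlC x : (inl x \in C) = (x \in S).
  rewrite inE mem_imset; last by move=> ? ? [].
  by case: (e s t); rewrite !inE ?orbF.
have sS : s \notin S by rewrite !inE eqxx.
have tS : t \notin S by rewrite !inE eqxx orbT.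
exists C; split.
- apply/is_st_cutP/and4P; split; rewrite ?inlC //.
    apply/forallP => F; apply/implyP; rewrite inE => /orP[/imsetP[] //|].
    case est: (e s t); rewrite inE // => /eqP[->].
    by rewrite inE; apply/existsP; exists s; apply/existsP; exists t; rewrite est eqxx.
  (* [Z] is closed under the edges that survive C and omits t. If x in Z is not s and has a
     neighbour y outside A and {s, t}, then (x, y) is in E and x is not in P, so y is in Q; y
     outside S then keeps y out of P and B. *)
  pose Z := [pred x | (x == s) || [&& x != s, x != t, x \notin P, x \notin B
                                    & (x \in A) || (x \in Q)]].
  have inZ y : y != s -> y != t -> y \notin S -> (y \in A) || (y \in Q) -> y \in Z.
    move=> ys yt; rewrite in_setD in_set in_set2 (negPf ys) (negPf yt) /= => yS yAQ.
    rewrite inE ys yt yAQ orbC /= andbT; move: yS yAQ.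
    by do 4!case: (y \in _).
  have stepZ x y : x \in Z -> del e C x y -> y \in Z.
    move=> xZ /and4P[exy _]; rewrite inlC => yS xyC.
    have [->|ys] := eqVneq y s; first by rewrite inE eqxx.
    move: xZ; rewrite inE; have [xs _|xs /and5P[_ xt xP xB _]] := eqVneq x s.
      rewrite xs in exy xyC.
      have yt : y != t.
        by apply: contraNneq xyC => yt; rewrite yt in exy *; rewrite /C exy !inE eqxx orbT.
      by apply: inZ => //; rewrite [y \in A]inE exy yt.
    have yt : y != t by apply: contraNneq xB => yt; rewrite inE -yt exy xs.
    apply: inZ => //; case yA: (y \in A) => //=.
    have := cov x y; rewrite (negPf xP); apply.
    by rewrite inE /= xB yA /e' exy !inE (negPf xs) (negPf xt) (negPf ys) (negPf yt) orbT.
  have stepZs x p : x \in Z -> path (del e C) x p -> last x p \in Z.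
    by elim: p x => //= y p IHp x xZ /andP[/(stepZ _ _ xZ)/IHp].
  apply/negP => /connectP[p]; have sZ : s \in Z by rewrite inE eqxx.
  move/(stepZs _ _ sZ) => /[swap] <-.
  by rewrite inE eq_sym (negPf neq_st) eqxx andbF.
- apply: leq_trans cardC _.
  pose f x := if [pick y | (x, y) \in M] is Some y then y else x.
  pose D := fst @: M.
  have fM x : x \in D -> (x, f x) \in M.
    case/imsetP=> -[x' y] /= xyM ->; rewrite /f; case: pickP => // /(_ y).
    by rewrite xyM.
  have fE x : x \in D -> (x, f x) \in E by move=> /fM; apply/subsetP.
  have f_inj : {in D &, injective f}.
    by move=> x y /fM xM /fM yM eq_f; have [] := M2 _ _ xM yM eq_f.
  have [||X sXA [leX XB XP]] := @linkage _ D f f_inj A B.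
  - rewrite disjoint_sym disjoint_subset; apply/subsetP => _ /imsetP[x /fE xE ->].
    by move: xE; rewrite inE => /and3P[].
  - rewrite disjoint_sym disjoint_subset; apply/subsetP => x /fE.
    by rewrite inE => /and3P[].
  pose w a := traject f a (exit_time D f a).+1.
  apply: leq_trans (@kappa_ge_linkage s t X w neq_st _ _ _).
  + rewrite leq_add2r -(leq_add2r #|'I_n|); apply: leq_trans leX.
    apply: leq_trans (_ : #|A| + #|B| + (#|P| + #|Q|) <= _); last first.
      by rewrite leq_add2l card_in_imset.
    rewrite -[#|'I_n|]sum1_card !card_sum -!big_split /=.
    apply: leq_sum => x _.
    have : ~~ (x \in A) -> ~~ (x \in B) -> (x \in P) || (x \in Q).
      by move=> xA xB; apply: cov; rewrite inE /= xA xB eqxx.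
    rewrite in_setD in_set.
    case: (x \notin [set s; t]); do 4!case: (x \in _) => //=; by move=> /(_ isT isT).
  + by move=> a _; rewrite /w inE eqxx.
  + move=> a aX.
    (* The points of a chain up to its exit are distinct, so no step is a diagonal pair (x, x). *)
    have step i : i < exit_time D f a -> e' (iter i f a) (iter i.+1 f a).
      move=> lt_i; have := fE _ (exit_time_before lt_i).
      rewrite inE /= => /and3P[_ _ /orP[/eqP eq_i|//]].
      have [_ /eqP] := XP _ _ aX aX i i.+1 (ltnW lt_i) lt_i eq_i.
      by rewrite -[i in i == _]addn0 -addn1 eqn_add2l.
    have aA : a \in A by apply: (subsetP sXA).
    have w_inner : {in w a, forall x, x \notin [set s; t]}.
      move=> _ /trajectP[[|i] lt_i ->]; last by case/and3P: (step i lt_i).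
      move: aA; rewrite !inE negb_or => /andP[esa ->]; rewrite andbT.
      by apply: contraTneq esa => /= ->; rewrite e_irr.
    have w_uniq : uniq (w a).
      apply/(uniqP a) => i j; rewrite !inE !size_traject => li lj.
      by rewrite !nth_traject // => eq_ij; have [] := XP _ _ aX aX i j li lj eq_ij.
    apply/and4P; split; rewrite ?last_rcons //.
      rewrite rcons_path /= last_traject; apply/andP; split; last first.
        by have := XB a aX; rewrite inE => /andP[].
      apply/andP; split; first by move: aA; rewrite inE => /andP[].
      apply/(pathP a) => i; rewrite size_traject => lt_i.
      rewrite -[a :: _]/(traject f a _.+1) nth_traject; last exact: ltnW.
      rewrite (set_nth_default (f a)) ?size_traject // nth_traject // -iterSr.
      by case/and3P: (step i lt_i).
    have out x : x \in [set s; t] -> x \notin w a.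
      by move=> xst; apply/negP => /w_inner; rewrite xst.
    rewrite cons_uniq rcons_uniq mem_rcons in_cons (negPf neq_st) w_uniq.
    by rewrite !out // !inE eqxx ?orbT.
  + move=> a b aX bX x /trajectP[i li ->] /trajectP[j lj] eq_ij.
    by have [] := XP _ _ aX bX i j li lj eq_ij.
- apply: leq_trans cardC _.
  have : #|S| + 2 <= n.
    have : #|S| <= #|~: [set s; t]|.
      by apply/subset_leq_card/subsetP => x; rewrite !inE => /andP[].
    by move: (cardsC [set s; t]); rewrite cards2 neq_st card_ord; clear; lia.
  by case: (e s t); clear; lia.
Qed.

End Menger.

(** * A list of O(kn) cuts serving all separable pairs *)

Section CutList.
Variables (n : nat) (e : rel 'I_n) (k : nat).
Hypotheses (e_sym : symmetric e) (k_gt0 : 0 < k).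
Implicit Types (s t x y : 'I_n) (C : {set elt n}) (U : {set 'I_n}).

Lemma del_sym C : symmetric (del e C).
Proof.
move=> x y; rewrite /del /= (e_sym x) setUC; case: (e y x) => //=.
by case: (inl x \notin C); case: (inl y \notin C).
Qed.

Lemma is_st_cut_sym s t C : is_st_cut e s t C = is_st_cut e t s C.
Proof.
rewrite /is_st_cut (sym_connect_sym (del_sym C)); congr (_ && _).
by case: (inl s \notin C); case: (inl t \notin C).
Qed.

Definition separable s t : bool :=
  [exists C : {set elt n}, (#|C| <= k) && is_st_cut e s t C].

Definition some_cut s t : {set elt n} :=
  odflt set0 [pick C : {set elt n} | (#|C| <= k) && is_st_cut e s t C].

Lemma some_cutP s t : separable s t ->
  #|some_cut s t| <= k /\ is_st_cut e s t (some_cut s t).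
Proof.
rewrite /separable /some_cut => /existsP[C hC]; case: pickP => [C' /andP[]//|/(_ C)].
by rewrite hC.
Qed.

(** [U] restricts only the pairs to be served; the cuts are cuts of the whole graph, which never
    changes in the recursion. *)
Definition separating U (cs : seq {set elt n}) : Prop :=
  (forall C, C \in cs -> #|C| <= k /\ exists s t, s != t /\ is_st_cut e s t C) /\
  {in U &, forall s t, s != t -> separable s t ->
     exists2 C, C \in cs & is_st_cut e s t C}.

(** One side is the component of s after deleting C, the other is everything else outside C; only
    terminals that are nodes of C are left over. *)
Lemma cut_sides U s t C : s \in U -> t \in U -> is_st_cut e s t C ->
  exists A1 A2 : {set 'I_n}, [/\ s \in A1, t \in A2, [disjoint A1 & A2] &
   [/\ A1 \subset U, A2 \subset U,
    #|U :\: (A1 :|: A2)| <= #|C| &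
    {in A1 & A2, forall x y, x != y /\ is_st_cut e x y C}]].
Proof.
move=> sU tU /and4P[Ce sC tC nst].
pose A := [set v | connect (del e C) s v].
pose N := [set v | inl v \in C].
have AN v : v \in A -> v \notin N.
  rewrite !inE; have [<- //|neq] := eqVneq s v.
  rewrite (sym_connect_sym (del_sym C)) => /connectP[[|x p] /= pp lp]; first by rewrite lp eqxx in neq.
  by case/andP: pp => /and4P[].
exists (U :&: A), (U :\: (A :|: N)); split.
- by rewrite !inE sU connect0.
- by rewrite !inE tU (negPf nst) (negPf tC).
- rewrite disjoint_subset; apply/subsetP => v; rewrite !inE => /andP[_ ->] //.
split; first exact: subsetIl.
- exact: subsetDl.
- apply: leq_trans (_ : #|inl @: N| <= _).
    rewrite card_imset; last by move=> ? ? [].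
    apply/subset_leq_card/subsetP => v; rewrite !inE.
    by case: (connect _ _ _); case: (v \in U); case: (inl v \in C).
  by apply/subset_leq_card/subsetP => _ /imsetP[v vN ->]; rewrite inE in vN.
- move=> x y; rewrite !inE => /andP[_ sx] /andP[/norP[sy yN] _]; split.
    by apply: contraNneq sy => <-.
  apply/and4P; split=> //.
    by have := AN x; rewrite !inE; apply.
  by apply: contra sy; apply: connect_trans.
Qed.

(** A pair that meets A1 is served by C if its other end is in A2, and otherwise gets a cut of its
    own. *)
Lemma separating_peel U (A1 A2 : {set 'I_n}) C cs : separating (U :\: A1) cs ->
  A1 \subset U -> #|C| <= k ->
  {in A1 & A2, forall x y, is_st_cut e x y C} ->
  (exists s t, s != t /\ is_st_cut e s t C) ->
  exists2 cs', separating U cs' &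
    size cs' <= 1 + #|A1| * #|U :\: A2| + size cs.
Proof.
move=> [cs_cut cs_sep] sA1 Ck A12 Cst.
pose ps := [seq some_cut p.1 p.2 | p <- enum (setX A1 (U :\: A2)) &
              (p.1 != p.2) && separable p.1 p.2].
exists (C :: ps ++ cs); last first.
  rewrite /= size_cat size_map -add1n addnA leq_add2r leq_add2l size_filter.
  by apply: leq_trans (count_size _ _) _; rewrite -cardE cardsX.
split=> [C'|s t sU tU neq sep].
  rewrite inE mem_cat => /or3P[/eqP-> //|/mapP[[x y]]|/cs_cut//].
  rewrite mem_filter /= => /andP[/andP[neq sep] _] ->.
  by have [? ?] := some_cutP sep; split=> //; exists x, y.
have one x y : x \in A1 -> y \in U -> x != y -> separable x y ->
    exists2 C', C' \in C :: ps ++ cs & is_st_cut e x y C'.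
  move=> xA yU nxy sxy; case yA: (y \in A2).
    by exists C; [rewrite mem_head|apply: A12].
  exists (some_cut x y); last by have [] := some_cutP sxy.
  rewrite inE mem_cat (_ : _ \in ps) ?orbT //.
  apply/mapP; exists (x, y) => //; rewrite mem_filter /= nxy sxy mem_enum.
  by rewrite !inE /= xA yA yU.
have [sA|sA] := boolP (s \in A1); first exact: one.
have [tA|tA] := boolP (t \in A1).
  have [||C' C'in C'cut] := one t s tA sU.
  - by rewrite eq_sym.
  - by apply/existsP; case/existsP: sep => C0; rewrite is_st_cut_sym; exists C0.
  by exists C'; rewrite // is_st_cut_sym.
have [||C' C'in C'cut] := cs_sep s t _ _ neq sep; rewrite ?inE ?sA ?tA //.
by exists C' => //; rewrite inE mem_cat C'in !orbT.
Qed.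

(** A pair that avoids A1 or avoids A2 is left to a recursive list; any other has one end on each
    side, since these are disjoint, and C serves it. *)
Lemma separating_split U (A1 A2 : {set 'I_n}) C cs1 cs2 :
  separating (U :\: A2) cs1 -> separating (U :\: A1) cs2 -> #|C| <= k ->
  {in A1 & A2, forall x y, is_st_cut e x y C} ->
  (exists s t, s != t /\ is_st_cut e s t C) -> [disjoint A1 & A2] ->
  separating U (C :: cs1 ++ cs2).
Proof.
move=> [cut1 sep1] [cut2 sep2] Ck A12 Cst dA; split=> [C'|s t sU tU neq sep].
  by rewrite inE mem_cat => /or3P[/eqP-> //|/cut1//|/cut2//].
have [/andP[sA tA]|h12] := boolP ((s \in A1) && (t \in A2)).
  by exists C; [rewrite mem_head|apply: A12].
have [/andP[sA tA]|h21] := boolP ((s \in A2) && (t \in A1)).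
  by exists C; [rewrite mem_head|rewrite is_st_cut_sym; apply: A12].
have [/orP nA2|] := boolP ((s \in A2) || (t \in A2)).
  have [||C' C'in C'cut] := sep2 s t _ _ neq sep.
  - rewrite inE sU andbT; case: nA2 => [sA|tA]; first by rewrite (disjointFl dA).
    by move: h12; rewrite tA andbT.
  - rewrite inE tU andbT; case: nA2 => [sA|tA]; last by rewrite (disjointFl dA).
    by move: h21; rewrite sA.
  by exists C' => //; rewrite inE mem_cat C'in !orbT.
rewrite negb_or => /andP[sA tA].
have [||C' C'in C'cut] := sep1 s t _ _ neq sep; rewrite ?inE ?sA ?tA //.
by exists C' => //; rewrite inE mem_cat C'in !orbT.
Qed.

(* The slope doubles beyond 3k, so that a split, which counts the at most [k]
   remaining nodes twice, is paid for by the constant term -3k of each part. *)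
Definition cut_bound m : nat := (4 * k + 1) * (m + (m - 3 * k)).

(** Of the 4k + 1 cuts charged to each of the a terminals, a + c <= 4k pay for its pairs; the
    remaining ones pay for C. *)
Lemma cut_bound_peel a c m : 0 < a -> a <= m -> c <= k -> a <= 3 * k ->
  1 + a * (a + c) + cut_bound (m - a) <= cut_bound m.
Proof.
move=> a0 am ck a3; apply: leq_trans (_ : a * (4 * k + 1) + cut_bound (m - a) <= _).
  by rewrite leq_add2r; nia.
by rewrite /cut_bound mulnC -mulnDr leq_mul2l; apply/orP; right; lia.
Qed.

(** Up to the factor 4k + 1, the left side gains 2c + 1 and loses a further 3k; 2c + 1 <= 3k as c <=
    k and k > 0. *)
Lemma cut_bound_split a b c : c <= k -> 3 * k < a -> 3 * k < b ->
  1 + cut_bound (a + c) + cut_bound (b + c) <= cut_bound (a + b + c).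
Proof.
move=> ck a3 b3; rewrite /cut_bound.
apply: leq_trans (_ : (4 * k + 1) * (1 + (a + c + (a + c - 3 * k)) + (b + c + (b + c - 3 * k))) <= _).
  by rewrite !mulnDr muln1; lia.
by rewrite leq_mul2l; apply/orP; right; lia.
Qed.

Lemma separating_exists U :
  exists2 cs, separating U cs & size cs <= cut_bound #|U|.
Proof.
have [m] := ubnP #|U|; elim: m U => // m IHm U ltUm.
have [/exists_inP[s sU /exists_inP[t tU /andP[neq sep]]]|nosep] :=
  boolP [exists s in U, exists t in U, (s != t) && separable s t]; last first.
  exists [::] => //; split=> // s t sU tU neq sep.
  by case/negP: nosep; apply/exists_inP; exists s => //; apply/exists_inP; exists t;
     rewrite // neq.
have [Ck Cst] := some_cutP sep; move: (some_cut s t) Ck Cst => C Ck Cst.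
have [A1 [A2 [sA1 tA2 dA [sA1U sA2U NC A12]]]] := cut_sides sU tU Cst.
(* B1 is the smaller side: if it has more than 3k terminals, so has B2. *)
have [B1 [B2 [dB [sB1 sB2 B1gt B2gt] le_B [B12 NB]]]] : exists B1 B2 : {set 'I_n},
    [/\ [disjoint B1 & B2], [/\ B1 \subset U, B2 \subset U, 0 < #|B1| & 0 < #|B2|],
        #|B1| <= #|B2| & {in B1 & B2, forall x y, is_st_cut e x y C} /\
        #|U :\: (B1 :|: B2)| <= k].
  have A1gt : 0 < #|A1| by apply/card_gt0P; exists s.
  have A2gt : 0 < #|A2| by apply/card_gt0P; exists t.
  have [le|/ltnW le] := leqP #|A1| #|A2|.
    exists A1, A2; split=> //; split; last exact: leq_trans NC Ck.
    by move=> x y xA yA; case: (A12 x y xA yA).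
  exists A2, A1; rewrite disjoint_sym setUC; split=> //; split; last exact: leq_trans NC Ck.
  by move=> x y xA yA; rewrite is_st_cut_sym; case: (A12 y x yA xA).
have Cex : exists s t, s != t /\ is_st_cut e s t C by exists s, t.
have cardU : #|U| = #|B1| + #|B2| + #|U :\: (B1 :|: B2)|.
  rewrite -(cardsID (B1 :|: B2) U); congr (_ + _).
  rewrite (setIidPr _) ?subUset ?sB1 //; have := cardsUI B1 B2.
  by rewrite (disjoint_setI0 dB) cards0 addn0.
have cardU1 : #|U :\: B1| = #|U| - #|B1| by rewrite cardsD (setIidPr sB1).
have cardU2 : #|U :\: B2| = #|U| - #|B2| by rewrite cardsD (setIidPr sB2).
set c := #|U :\: (B1 :|: B2)| in NB cardU.
have [|cs2 sep2 le2] := IHm (U :\: B1).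
  by move: ltUm; rewrite cardU1 cardU; clear -B1gt; lia.
have [le3|gt3] := leqP #|B1| (3 * k).
  have [cs' sep' le'] := separating_peel sep2 sB1 Ck B12 Cex; exists cs' => //.
  apply: leq_trans le' _.
  apply: leq_trans (_ : 1 + #|B1| * (#|B1| + c) + cut_bound (#|U| - #|B1|) <= _).
    rewrite cardU2 -cardU1 (_ : #|U| - #|B2| = #|B1| + c) ?leq_add2l //.
    by rewrite cardU; clear; lia.
  by apply: cut_bound_peel => //; rewrite cardU -addnA leq_addr.
have [|cs1 sep1 le1] := IHm (U :\: B2).
  by move: ltUm; rewrite cardU2 cardU; clear -B2gt; lia.
exists (C :: cs1 ++ cs2); first exact: separating_split sep1 sep2 Ck B12 Cex dB.
rewrite /= size_cat -add1n addnA.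
have -> : #|U| = #|B1| + #|B2| + c by [].
apply: leq_trans (cut_bound_split NB gt3 (leq_trans gt3 le_B)).
rewrite -addnA -[in X in _ <= X]addnA leq_add2l; apply: leq_add.
  by apply: leq_trans le1 _; rewrite cardU2 cardU (_ : _ - _ = #|B1| + c) //; clear; lia.
by apply: leq_trans le2 _; rewrite cardU1 cardU (_ : _ - _ = #|B2| + c) //; clear; lia.
Qed.

Lemma cut_bound_le m : cut_bound m <= 10 * (k * m).
Proof.
rewrite /cut_bound; apply: leq_trans (_ : (5 * k) * (2 * m) <= _); last by nia.
by apply: leq_mul; lia.
Qed.

End CutList.

(** * Sizes of encoded cuts *)

Lemma size_flatten_map_le (S T : eqType) (g : S -> seq T) (c : nat) (s : seq S) :
  (forall x, x \in s -> size (g x) <= c) ->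
  size (flatten [seq g x | x <- s]) <= c * size s.
Proof.
elim: s => [|x s IHs] H /=; first by rewrite muln0.
rewrite size_cat mulnS leq_add ?H ?mem_head //; apply: IHs => y ys.
by apply: H; rewrite inE ys orbT.
Qed.

Section Encoding.
Variables (n : nat) (e : rel 'I_n).
Implicit Types (C : {set elt n}).

Lemma size_encode_cut C : (forall A, inr A \in C -> A \in edges e) ->
  size (encode_cut C) <= 1 + 2 * #|C|.
Proof.
move=> Ce; rewrite /encode_cut /= -add1n leq_add2l cardE.
apply: size_flatten_map_le => -[x|A] //=; rewrite mem_enum => /Ce.
rewrite inE size_map -cardE => /existsP[x /existsP[y /andP[_ /eqP->]]].
by rewrite cards2; case: (x != y).
Qed.

Lemma encode_cut_small C w : #|C| <= n -> w \in encode_cut C -> w <= n.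
Proof.
move=> Cn; rewrite inE => /orP[/eqP-> //|/flattenP[_ /mapP[[x|A] _ ->]]] /=.
  by rewrite !inE => /orP[] /eqP->; apply: ltnW.
by case/mapP=> x _ ->; apply: ltnW.
Qed.

End Encoding.

(** * The query programs *)

(* The memory starts with [n] and the [n * n] table in row-major order. *)
Definition lookup : seq instr :=
  [:: IConst 2 0; ILoad 2 2; IMul 3 0 2; IAdd 3 3 1; IConst 4 1; IAdd 3 3 4;
      ILoad 3 3].
(** Register 4 still holds 1, and truncated subtraction turns entry 0 into 1 and any pointer into
    0. *)
Definition con_query : seq instr := lookup ++ [:: ISub 5 4 3; IHalt 5].
Definition cut_query : seq instr := lookup ++ [:: IHalt 3].

Lemma lookup_queries (W n : nat) (mem : seq nat) (s t : nat) :
  s < n -> t < n -> n * n < size mem -> n * n < 2 ^ W -> nth 0 mem 0 = n ->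
  query W mem con_query 9 s t = Some (1 - nth 0 mem (s * n + t).+1) /\
  query W mem cut_query 9 s t = Some (nth 0 mem (s * n + t).+1).
Proof.
move=> sn tn szM nW M0.
have stn : (s * n + t).+1 <= n * n by nia.
have W1 : 1 < 2 ^ W by apply: leq_ltn_trans nW; nia.
have m0 : 0 < size mem by apply: leq_ltn_trans szM.
have m1 : (s * n) %% 2 ^ W = s * n by rewrite modn_small //; lia.
have m2 : (s * n + t) %% 2 ^ W = s * n + t by rewrite modn_small //; lia.
have m3 : (s * n + t + 1) %% 2 ^ W = (s * n + t).+1 by rewrite addn1 modn_small //; lia.
have lt3 : (s * n + t).+1 < size mem by lia.
by split; rewrite /query /= /upd /= mod0n m0 M0 m1 m2 (modn_small W1) m3 lt3.
Qed.

(** * Memory layout *)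

Section DataStructure.
Variables (n : nat) (e : rel 'I_n) (k : nat) (cs : seq {set elt n}).

Definition cut_index (s t : 'I_n) : nat := find (is_st_cut e s t) cs.

(** The offset (n * n).+1 skips the word n and the table; it also keeps pointers nonzero, so 0 is
    free to mean more than k paths. *)
Definition table_entry (s t : 'I_n) : nat :=
  if kappa e s t <= k then
    (n * n).+1 + size (flatten [seq encode_cut C | C <- take (cut_index s t) cs])
  else 0.

Definition table_word (i : nat) : nat :=
  if insub (i %/ n) is Some s then
    if insub (i %% n) is Some t then table_entry s t else 0
  else 0.

Definition cut_ds : ds n := DS (n :: mkseq table_word (n * n)) cs.

Lemma nth_cut_ds (s t : 'I_n) :
  nth 0 (ds_mem cut_ds) (s * n + t).+1 = table_entry s t.
Proof.
have stn : s * n + t < n * n by move: (ltn_ord s) (ltn_ord t); nia.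
have n0 : 0 < n by apply: leq_ltn_trans (ltn_ord s).
rewrite /ds_mem nth_cat /= size_mkseq ltnS stn nth_mkseq // /table_word.
by rewrite divnMDl // modnMDl divn_small // modn_small // addn0 !valK.
Qed.

Lemma ds_ptr_cut_ds (s t : 'I_n) : kappa e s t <= k ->
  table_entry s t = ds_ptr cut_ds (cut_index s t).
Proof. by move=> st; rewrite /table_entry st /ds_ptr /= size_mkseq. Qed.

Lemma size_cut_ds : size (ds_mem cut_ds) =
  (n * n).+1 + size (flatten [seq encode_cut C | C <- cs]).
Proof. by rewrite /ds_mem size_cat /= size_mkseq. Qed.

(** On the diagonal no cut exists, [find] returns the length of the list, and the entry may point
    just past the memory. *)
Lemma table_entry_le s t : table_entry s t <= size (ds_mem cut_ds).
Proof.
rewrite /table_entry size_cut_ds; case: ifP => // _; rewrite leq_add2l.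
rewrite -{2}(cat_take_drop (cut_index s t) cs) map_cat flatten_cat size_cat.
exact: leq_addr.
Qed.

Lemma cut_ds_words w : (forall C, C \in cs -> #|C| <= n) ->
  w \in ds_mem cut_ds -> w <= n \/ w <= size (ds_mem cut_ds).
Proof.
move=> csn; rewrite mem_cat => /orP[|/flattenP[_ /mapP[C Ccs ->]] wC]; last first.
  by left; apply: encode_cut_small wC; apply: csn.
rewrite inE => /orP[/eqP->|/mapP[i _ ->]]; first by left.
right; rewrite /table_word; do 2!case: insub => // ?; exact: table_entry_le.
Qed.

End DataStructure.

(** The power is P ^ 8 with n < P and 2 <= P: five factors absorb 32, three absorb n ^ 3. *)
Lemma word_bits_gt n w : w <= 32 * n ^ 3 -> w < 2 ^ word_bits 8 n.
Proof.
move=> wn; rewrite /word_bits mulnC expnM; set P := 2 ^ _.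
have nP : n < P by rewrite trunc_log_ltn.
have P2 : 2 <= P by rewrite -[X in X <= _]expn1 leq_exp2l.
apply: leq_ltn_trans wn _; rewrite (_ : 8 = 5 + 3) // expnD.
apply: leq_ltn_trans (_ : P ^ 5 * n ^ 3 < _).
  by rewrite leq_mul2r -[X in X <= _]/(2 ^ 5) leq_exp2r // P2 orbT.
by rewrite ltn_pmul2l ?ltn_exp2r // expn_gt0 (ltn_trans _ P2).
Qed.

(** * Constants and assembly *)

Theorem theorem2 :
  exists (con cut : seq instr) (c_space c_list c_time c_word : nat),
  0 < c_word /\
  forall (k n : nat) (e : rel 'I_n),
    1 <= k -> symmetric e -> irreflexive e ->
  exists D : ds n,
    [/\ size (ds_mem D) <= c_space * (k ^ 2 * n + n ^ 2),
        all (fun x => x < 2 ^ word_bits c_word n) (ds_mem D),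
        size (ds_cuts D) <= c_list * (k * n),
        forall C, C \in ds_cuts D -> is_cut e C
      & forall s t : 'I_n, s != t ->
          query (word_bits c_word n) (ds_mem D) con c_time s t
            = Some (nat_of_bool (k.+1 <= kappa e s t))
          /\
          (kappa e s t <= k ->
           exists i : nat,
             [/\ i < size (ds_cuts D),
                 query (word_bits c_word n) (ds_mem D) cut c_time s t
                   = Some (ds_ptr D i),
                 st_cut e s t (nth set0 (ds_cuts D) i)
               & #|nth set0 (ds_cuts D) i| <= k])].
Proof.
(* Space 31: at most 30 k^2 n words of records, plus n^2 + 1 for the table and n. List 10:
   [cut_bound_le]. Time 9: the length of [con_query]. Word 8: [word_bits_gt]. *)
exists con_query, cut_query, 31, 10, 9, 8; split=> // k n e k_gt0 e_sym e_irr.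
(* For n = 0 the space bound is 0, so not even the word n may be stored. *)
have [n0|n_gt0] := posnP n.
  by subst n; exists (DS [::] [::]); split=> // -[].
(* Word length depends on n alone, so sizes and pointers must be polynomial in n even for huge k;
   Menger cuts have at most n elements, so capping k at n loses no pair. *)
pose k' := minn k n.
have k'_gt0 : 0 < k' by rewrite leq_min k_gt0.
have k'n : k' <= n by apply: geq_minr.
have k'k : k' <= k by apply: geq_minl.
have [cs [cs_cut cs_sep] cs_size] := separating_exists e_sym k'_gt0 [set: 'I_n].
have {}cs_size : size cs <= 10 * (k' * n).
  by apply: leq_trans cs_size _; rewrite cardsT card_ord cut_bound_le.
have flat_le : size (flatten [seq encode_cut C | C <- cs]) <= 30 * (k' ^ 2 * n).
  (* A record takes at most 1 + 2k' <= 3k' words. *)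
  apply: leq_trans (_ : (3 * k') * size cs <= _); last by nia.
  apply: size_flatten_map_le => C /cs_cut[Ck [s [t [_ /is_st_cutP[Ce _ _ _]]]]].
  by apply: leq_trans (size_encode_cut Ce) _; lia.
pose D := cut_ds e k cs; have szD := size_cut_ds e k cs; rewrite -/D in szD.
have memW w : w \in ds_mem D -> w < 2 ^ word_bits 8 n.
  move=> /cut_ds_words[C /cs_cut[Ck _]|wn|wn]; first exact: leq_trans Ck k'n.
    by apply: word_bits_gt; nia.
  apply: word_bits_gt; apply: leq_trans wn _; rewrite -/D szD.
  have : k' ^ 2 * n <= n ^ 3 by rewrite [n ^ 3]expnSr leq_mul2r leq_exp2r // k'n orbT.
  by move: flat_le; nia.
exists D; split.
- rewrite szD; have : k' ^ 2 * n <= k ^ 2 * n by rewrite leq_mul2r leq_exp2r // k'k orbT.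
  by move: flat_le; nia.
- exact/allP.
- by apply: leq_trans cs_size _; nia.
- by move=> C /cs_cut[_ [s [t [neq /is_st_cutP]]]]; exists s, t.
move=> s t neq.
have nnW : n * n < 2 ^ word_bits 8 n by apply: word_bits_gt; nia.
have nnD : n * n < size (ds_mem D) by rewrite szD ltnS leq_addr.
have [-> ->] := lookup_queries (ltn_ord s) (ltn_ord t) nnD nnW erefl.
rewrite nth_cut_ds; split.
  by rewrite /table_entry ltnNge; case: (kappa e s t <= k).
move=> st; rewrite (ds_ptr_cut_ds _ st).
have [C [Ccut Ck Cn]] := menger e_irr neq.
have sep : separable e k' s t.
  by apply/existsP; exists C; rewrite leq_min (leq_trans Ck st) Cn; apply/is_st_cutP.
have has_cut : has (is_st_cut e s t) cs.
  by have [C' ? ?] := cs_sep s t (in_setT s) (in_setT t) neq sep; apply/hasP; exists C'.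
have idx_lt : cut_index e cs s t < size cs by rewrite -has_find.
exists (cut_index e cs s t); split=> //; first exact/is_st_cutP/nth_find.
by have [Ck' _] := cs_cut _ (mem_nth set0 idx_lt); apply: leq_trans Ck' k'k.
Qed.
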